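(* Let $(c_n)$ be a sequence of reals and let $p=p(n)=\sqrt{\frac{2\log n+\log\log n+c_n}{n}}$ (assumed to lie in $[0,1]$). Let $\mathbb G_{n,n,p}$ be the random bipartite graph with parts $X,Y$, $|X|=|Y|=n$, in which each of the $n^2$ pairs $xy$ with $x\in X,y\in Y$ is an edge independently with probability $p$. Then $$\lim_{n\to\infty}\Pr[\mathbb G_{n,n,p}\text{ satisfies the double Hall property}]=\begin{cases}0 & \text{if } c_n\to-\infty,\\ e^{-e^{-c}} & \text{if } c_n\to c\in\mathbb R,\\ 1 & \text{if } c_n\to+\infty.\end{cases}$$
   Context: $\log$ is the natural logarithm. For a vertex set $S$, $\Lambda^2(S)$ denotes the set of vertices adjacent to at least two vertices of $S$. A bipartite graph $G=(X,Y)$ with $|X|\ge 2$ satisfies the double Hall property if $|\Lambda^2(S)|\ge |S|$ for every $S\subseteq X$ with $|S|\ge 2$. *)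

(* Defs.v *)
From HB Require Import structures.
From mathcomp Require Import all_boot all_order all_algebra.
From mathcomp Require Import all_classical all_reals all_analysis.
Set Implicit Arguments.
Unset Strict Implicit.
Unset Printing Implicit Defensive.
Import Order.TTheory GRing.Theory Num.Theory.
Import numFieldNormedType.Exports.
Local Open Scope ring_scope.

Section BipartiteGraph.
Variables X Y : finType.

(* A bipartite graph with parts X and Y is given by its set of edges. *)
Definition bigraph := {set X * Y}.

(* Vertices of X are only adjacent to vertices of Y, so for S included in X
   the set Lambda^2(S) is a subset of Y. *)
Definition Lambda2 (G : bigraph) (S : {set X}) : {set Y} :=
  [set y | (2 <= #|[set x in S | (x, y) \in G]|)%N].

Definition double_Hall (G : bigraph) : bool :=
  (2 <= #|X|)%N &&
  [forall S : {set X}, (2 <= #|S|)%N ==> (#|S| <= #|Lambda2 G S|)%N].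

End BipartiteGraph.

Section RandomBipartiteGraph.
Variables (R : realType) (n : nat) (p : R).

(* The product law: the pairs are edges independently, with probability p. *)
Definition Gnnp_law (G : bigraph 'I_n 'I_n) : R :=
  \prod_(xy : 'I_n * 'I_n) (if xy \in G then p else 1 - p).

Definition Gnnp_Pr (A : pred (bigraph 'I_n 'I_n)) : R :=
  \sum_(G : bigraph 'I_n 'I_n | A G) Gnnp_law G.

End RandomBipartiteGraph.

Section EdgeProbability.
Variables (R : realType) (c : nat -> R) (n : nat).

Definition edge_prob_sqr : R := (2 * ln n%:R + ln (ln n%:R) + c n) / n%:R.

Definition edge_prob : R := Num.sqrt edge_prob_sqr.

(* The first conjunct is needed because Num.sqrt is 0 on negative numbers. *)
Definition edge_prob_valid : Prop := 0 <= edge_prob_sqr /\ 0 <= edge_prob <= 1.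

End EdgeProbability.

(* Main.v *)
Require Import Defs.
From HB Require Import structures.
From mathcomp Require Import all_boot all_order all_algebra.
From mathcomp Require Import all_classical all_reals all_analysis.
From mathcomp Require Import ring lra zify.

(** The double Hall property is increasing, so the probability is monotone in
    the edge probability and it is enough to treat a constant sequence [c]: the
    three limits then follow by sandwiching.

    For constant [c], write [L = ln n], so that [n p^2 = 2 L + ln L + c].  Two
    fixed vertices of [X] have at most one common neighbour with probability
    asymptotic to [2 exp(-c) / n^2], so that about [exp(-c)] pairs violate the
    property on average.  Disjoint pairs behave independently, and two pairs
    sharing a vertex are both bad with probability [o(n^-3)] by a Chernoff
    bound.  Removing the pairs one at a time, the probability that no pair is
    bad differs from [(1 - Pr[bad])^C(n,2)] by at most the sum of
    [Pr[both bad] + Pr[bad]^2] over dependent pairs, which tends to [0].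

    A union bound shows that w.h.p. no larger set is bad: a bad set of size
    [m + 1] has [n - m] vertices of [Y] with at most one neighbour in it, an
    event of probability [((1 - p)^m (1 + m p))^(n - m)]. *)

Set Implicit Arguments.
Unset Strict Implicit.
Unset Printing Implicit Defensive.
Import Order.TTheory GRing.Theory Num.Theory.
Import numFieldNormedType.Exports.
Local Open Scope ring_scope.

(** * Random subsets of a finite type *)

Section Bernoulli.
Variables (R : realType) (T : finType).
Implicit Types (p q : R) (A B D S G H K : {set T}) (f g : {set T} -> R).

Lemma sum_set_prod (F : T -> bool -> R) :
  \sum_(A : {set T}) \prod_x F x (x \in A) = \prod_x (F x true + F x false).
Proof.
transitivity (\prod_x \sum_(b : bool) F x b); last first.
  by apply: eq_bigr => x _; rewrite big_bool.
rewrite bigA_distr_bigA /=.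
rewrite (reindex (fun A : {set T} => [ffun x => x \in A])) /=; last first.
  exists (fun h : {ffun T -> bool} => [set x | h x]) => [A|h] _.
    by apply/setP => x; rewrite inE ffunE.
  by apply/ffunP => x; rewrite ffunE inE.
by apply: eq_bigr => A _; apply: eq_bigr => x _; rewrite ffunE.
Qed.

(** Factorising this indicator over the points lets [Ebern_prod] compute the law of a random set. *)
Lemma eq_set_prod A B :
  (A == B)%:R = \prod_x ((x \in A) == (x \in B))%:R :> R.
Proof.
case: eqP => [<-|/eqP nB]; first by rewrite big1// => x _; rewrite eqxx.
have [x xP] : exists x, (x \in A) != (x \in B).
  apply/existsP; apply: contraNT nB; rewrite negb_exists => /forallP h.
  by apply/eqP/setP => x; have := h x; rewrite negbK => /eqP.
by rewrite (bigD1 x) //= (negPf xP) mul0r.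
Qed.

(** For [T := 'I_n * 'I_n] this is the product defining [Gnnp_law]. Probabilities are handled below
    as [Ebern] of 0/1 indicators. *)
Definition bern p A : R := \prod_x (if x \in A then p else 1 - p).

Definition Ebern p f : R := \sum_A bern p A * f A.

Lemma bern_ge0 p A : 0 <= p <= 1 -> 0 <= bern p A.
Proof.
move=> /andP[p0 p1]; apply: prodr_ge0 => x _; case: ifP => _ //.
by rewrite subr_ge0.
Qed.

Lemma eq_Ebern p f g : f =1 g -> Ebern p f = Ebern p g.
Proof. by move=> fg; apply: eq_bigr => A _; rewrite fg. Qed.

Lemma Ebern_le p f g : 0 <= p <= 1 -> (forall A, f A <= g A) ->
  Ebern p f <= Ebern p g.
Proof. by move=> p01 fg; apply: ler_sum => A _; rewrite ler_wpM2l// bern_ge0. Qed.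

Lemma Ebern_prod p (F : T -> bool -> R) :
  Ebern p (fun A => \prod_x F x (x \in A)) =
  \prod_x (p * F x true + (1 - p) * F x false).
Proof.
rewrite -(sum_set_prod (fun x b => (if b then p else 1 - p) * F x b)).
by apply: eq_bigr => A _; rewrite /bern -big_split.
Qed.

Lemma Ebern1 p : Ebern p (fun=> 1) = 1.
Proof.
transitivity (\prod_(x : T) (p * 1 + (1 - p) * 1)); last first.
  by rewrite big1// => x _; rewrite !mulr1 addrC subrK.
by rewrite -(Ebern_prod p (fun _ _ => 1)); apply: eq_Ebern => A; rewrite big1.
Qed.

Lemma EbernD p f g : Ebern p (fun A => f A + g A) = Ebern p f + Ebern p g.
Proof. by rewrite -big_split; apply: eq_bigr => A _; rewrite mulrDr. Qed.

Lemma EbernZ p k f : Ebern p (fun A => k * f A) = k * Ebern p f.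
Proof. by rewrite mulr_sumr; apply: eq_bigr => A _; rewrite mulrCA. Qed.

Lemma EbernB p f g : Ebern p (fun A => f A - g A) = Ebern p f - Ebern p g.
Proof. by rewrite -sumrB; apply: eq_bigr => A _; rewrite mulrBr. Qed.

Lemma Ebern_sum p (I : Type) (r : seq I) (P : pred I) (h : I -> {set T} -> R) :
  Ebern p (fun A => \sum_(i <- r | P i) h i A) =
  \sum_(i <- r | P i) Ebern p (h i).
Proof.
rewrite /Ebern exchange_big; apply: eq_bigr => A _; by rewrite mulr_sumr.
Qed.

(* Exchanging the two sets outside [D] preserves the law of an independent
   pair, and turns [f A * g A] into [f A * g A']. *)
Lemma Ebern_indep p D f g :
  (forall A B, A :&: D = B :&: D -> f A = f B) ->
  (forall A B, A :\: D = B :\: D -> g A = g B) ->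
  Ebern p (fun A => f A * g A) = Ebern p f * Ebern p g.
Proof.
move=> fD gD.
pose mix A B := (A :&: D) :|: (B :\: D).
have mixI A B : mix A B :&: D = A :&: D.
  by apply/setP => x; rewrite !inE; case: (x \in D); rewrite /= ?andbT ?orbF ?andbF.
have mixD A B : mix A B :\: D = B :\: D.
  by apply/setP => x; rewrite !inE; case: (x \in D); rewrite /= ?andbT ?orbF ?andbF.
have mixmix A B : mix (mix A B) (mix B A) = A.
  by rewrite {1}/mix mixI mixD setID.
have wmix A B : bern p (mix A B) * bern p (mix B A) = bern p A * bern p B.
  rewrite -!big_split; apply: eq_bigr => x _; rewrite !inE.
  by case: (x \in D); rewrite /= ?andbT ?orbF ?andbF// mulrC.
rewrite -[LHS]mulr1 -[in LHS](Ebern1 p) !big_distrlr /=.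
rewrite !pair_big /= (reindex (fun u => (mix u.1 u.2, mix u.2 u.1))) /=; last first.
  by exists (fun u => (mix u.1 u.2, mix u.2 u.1)) => -[A B] _ /=; rewrite !mixmix.
apply: eq_bigr => -[A B] _ /=.
rewrite (fD (mix A B) A)// (gD (mix A B) B)// mulr1.
by rewrite mulrAC wmix mulrACA.
Qed.

(** A point is missed by the union exactly when both independent sets miss it, so the union is again
    a random set with independent points. *)
Lemma Ebern_setU p q f :
  \sum_A \sum_B bern p A * bern q B * f (A :|: B) =
  Ebern (1 - (1 - p) * (1 - q)) f.
Proof.
transitivity (\sum_K (\sum_A \sum_B bern p A * bern q B * (A :|: B == K)%:R) * f K).
  under [RHS]eq_bigr do rewrite mulr_suml; rewrite [RHS]exchange_big /=.
  apply: eq_bigr => A _; under [RHS]eq_bigr do rewrite mulr_suml.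
  rewrite [RHS]exchange_big /=; apply: eq_bigr => B _.
  rewrite (bigD1 (A :|: B)) //= eqxx mulr1 big1 ?addr0// => K.
  by rewrite eq_sym => /negPf ->; rewrite mulr0 mul0r.
apply: eq_bigr => K _; congr (_ * _).
pose w (r : R) (b : bool) := if b then r else 1 - r.
have indE A B : (A :|: B == K)%:R =
    \prod_x ((x \in A) || (x \in B) == (x \in K))%:R :> R.
  by rewrite eq_set_prod; apply: eq_bigr => x _; rewrite inE.
(* [F x a] is the factor of [x] after summing over whether [x] lies in [B]. *)
pose F x a := w p a * (w q true * (a || true == (x \in K))%:R +
  w q false * (a || false == (x \in K))%:R).
transitivity (\sum_(A : {set T}) \prod_x F x (x \in A)).
  apply: eq_bigr => A _; under [LHS]eq_bigr do rewrite -mulrA.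
  rewrite -mulr_sumr big_split; congr (_ * _).
  rewrite -(sum_set_prod (fun x b => w q b * ((x \in A) || b == (x \in K))%:R)).
  apply: eq_bigr => B _.
  by rewrite indE -big_split.
rewrite sum_set_prod; apply: eq_bigr => x _; rewrite /F /w.
by case: (x \in K) => /=; ring.
Qed.

(* Coupling: a q-random set with p <= q is the union of a p-random set and of an
   independent r-random set, where [r] is the junk value 0 when p = 1. *)
Lemma Ebern_mono p q f : 0 <= p -> p <= q -> q <= 1 ->
  (forall A B, f A <= f (A :|: B)) -> Ebern p f <= Ebern q f.
Proof.
move=> p0 pq q1 fU.
pose r := (q - p) / (1 - p).
have p1 : p <= 1 by apply: le_trans q1.
have r0 : 0 <= r by rewrite divr_ge0// subr_ge0.
have r1 : r <= 1.
  have [pE|pN] := eqVneq p 1; first by rewrite /r pE subrr invr0 mulr0.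
  by rewrite ler_pdivrMr ?mul1r ?lerB// subr_gt0 lt_neqAle pN.
have -> : q = 1 - (1 - p) * (1 - r).
  have [pE|pN] := eqVneq p 1.
    by apply/eqP; rewrite pE subrr mul0r subr0 eq_le q1 /= -pE.
  rewrite /r; field; by rewrite subr_eq0 eq_sym.
rewrite -Ebern_setU; apply: ler_sum => A _.
rewrite -[leLHS]mulr1 -(Ebern1 r) /Ebern mulr_sumr; apply: ler_sum => B _.
rewrite mulr1 mulrAC ler_wpM2l ?fU// mulr_ge0 ?bern_ge0//; exact/andP.
Qed.

Lemma bern_cylinder p S B : B \subset S ->
  Ebern p (fun A => (A :&: S == B)%:R) = p ^+ #|B| * (1 - p) ^+ (#|S| - #|B|).
Proof.
move=> BS.
(* [F] is 1 off [S], so those points contribute [p + (1 - p) = 1]. *)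
pose F x a : R := ((x \in S) ==> (a == (x \in B)))%:R.
transitivity (Ebern p (fun A => \prod_x F x (x \in A))).
  apply: eq_Ebern => A; rewrite eq_set_prod; apply: eq_bigr => x _.
  rewrite /F inE; have := fintype.subsetP BS x.
  by case: (x \in S); case: (x \in B) => //= h; rewrite ?andbT ?andbF//; have := h isT.
rewrite Ebern_prod {}/F (bigID (mem B)) /=; congr (_ * _).
  rewrite -[RHS]prodr_const; apply: eq_bigr => x xB.
  by rewrite (fintype.subsetP BS)// xB /=; ring.
rewrite (bigID (mem S)) /= [X in _ * X]big1 ?mulr1; last first.
  by move=> x /andP[_ /negPf ->] /=; ring.
rewrite -cardsDS// -prodr_const; apply: eq_big => x; first by rewrite inE.
by move=> /andP[/negPf -> ->] /=; ring.
Qed.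

(** With [k = #|S|], the cases of no point and of one point add up to
    [(1 - p)^k + k p (1 - p)^(k - 1)]; taking out [(1 - p)^(k - 1)] leaves [1 + (k - 1) p]. *)
Lemma Ebern_card_le1 p S : (0 < #|S|)%N ->
  Ebern p (fun A => (#|A :&: S| <= 1)%:R) =
  (1 - p) ^+ #|S|.-1 * (1 + #|S|.-1%:R * p).
Proof.
move=> S0.
transitivity (Ebern p (fun A => (A :&: S == finset.set0)%:R +
    \sum_(x in S) (A :&: S == [set x])%:R)).
  apply: eq_Ebern => A; set C := A :&: S.
  have [C0|C0] := eqVneq C finset.set0.
    rewrite C0 cards0 /= big1 ?addr0// => x xS.
    by case: eqP => // /setP/(_ x); rewrite !inE eqxx.
  have [/cards1P[x Cx]|C1] := boolP (#|C| == 1)%N.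
    have xS : x \in S by have : x \in C by [rewrite Cx inE]; rewrite inE => /andP[].
    rewrite add0r (bigD1 x)//= Cx cards1 eqxx big1 ?addr0// => y /andP[yS yx].
    by case: eqP => // /setP/(_ y); rewrite !inE eqxx (negPf yx).
  rewrite add0r big1 => [|x xS].
    by rewrite leq_eqVlt (negPf C1) ltnS leqn0 cards_eq0 (negPf C0).
  by case: eqP => // E; move: C1; rewrite E cards1.
rewrite EbernD bern_cylinder ?finset.sub0set// cards0 subn0 expr0 mul1r.
rewrite Ebern_sum (eq_bigr (fun=> p * (1 - p) ^+ #|S|.-1)); last first.
  by move=> x xS; rewrite bern_cylinder ?finset.sub1set// cards1 expr1 subn1.
rewrite sumr_const; case: #|S| S0 => // k _.
by rewrite exprS -[_ *+ k.+1]mulr_natl -natr1 /=; ring.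
Qed.

End Bernoulli.

(** * Random bipartite graphs *)

Section Columns.
Variables (R : realType) (X Y : finType).
Implicit Types (p : R) (G : {set X * Y}).

Definition column G y : {set X} := [set x | (x, y) \in G].

(** The neighbourhoods of distinct vertices of [Y] involve disjoint sets of pairs, hence are
    independent. *)
Lemma Ebern_columns p (f : Y -> {set X} -> R) :
  Ebern p (fun G : {set X * Y} => \prod_y f y (column G y)) =
  \prod_y Ebern p (f y).
Proof.
rewrite bigA_distr_bigA /=.
rewrite (reindex (fun G : {set X * Y} => [ffun y => column G y])) /=; last first.
  exists (fun h : {ffun Y -> {set X}} => [set u | u.1 \in h u.2]) => [G|h] _.
    by apply/setP => -[x y]; rewrite inE ffunE inE.
  by apply/ffunP => y; rewrite ffunE; apply/setP => x; rewrite !inE.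
apply: eq_bigr => G _.
under [RHS]eq_bigr do rewrite ffunE.
rewrite big_split; congr (_ * _).
rewrite /bern exchange_big /= pair_big /=; apply: eq_bigr => -[x y] _.
by rewrite inE.
Qed.

(** Columns are independent and each satisfies [D] with probability [r], so the vertices whose
    column satisfies [D] form an [r]-random subset of [Y]. *)
Lemma Ebern_pushforward p r (D : pred {set X}) (g : {set Y} -> R) :
  Ebern p (fun A => (D A)%:R) = r ->
  Ebern p (fun G : {set X * Y} => g [set y | D (column G y)]) = Ebern r g.
Proof.
move=> Dr.
transitivity (Ebern p (fun G : {set X * Y} =>
    \sum_K g K * ([set y | D (column G y)] == K)%:R)).
  apply: eq_Ebern => G; set K := finset _.
  rewrite (bigD1 K) //= eqxx mulr1 big1 ?addr0// => K'.
  by rewrite eq_sym => /negPf ->; rewrite mulr0.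
rewrite Ebern_sum; apply: eq_bigr => K _; rewrite EbernZ mulrC; congr (_ * _).
pose f y A : R := (D A == (y \in K))%:R.
transitivity (Ebern p (fun G : {set X * Y} => \prod_y f y (column G y))).
  apply: eq_Ebern => G; rewrite eq_set_prod; apply: eq_bigr => y _.
  by rewrite inE.
rewrite Ebern_columns; apply: eq_bigr => y _; rewrite /f; case: (y \in K).
  by rewrite -Dr; apply: eq_Ebern => A; rewrite eqb_id.
transitivity (Ebern p (fun _ : {set X} => 1) - Ebern p (fun A : {set X} => (D A)%:R)).
  rewrite -EbernB; apply: eq_Ebern => A.
  by case: (D A); rewrite /= ?subr0 ?subrr.
by rewrite Ebern1 Dr.
Qed.

Lemma Lambda2_column G (S : {set X}) :
  Lambda2 G S = [set y | (2 <= #|column G y :&: S|)%N].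
Proof.
apply/setP => y; rewrite !inE; congr (2 <= _)%N.
by apply: eq_card => x; rewrite !inE andbC.
Qed.

Lemma Ebern_subset p (S : {set X}) :
  Ebern p (fun A => (S \subset A)%:R) = p ^+ #|S|.
Proof.
have := bern_cylinder p (fintype.subxx S); rewrite subnn expr0 mulr1 => <-.
by apply: eq_Ebern => A; rewrite (sameP finset.setIidPr eqP).
Qed.

Lemma card_setI2 (A S : {set X}) : #|S| = 2%N ->
  (2 <= #|A :&: S|)%N = (S \subset A).
Proof.
move=> S2; rewrite (sameP finset.setIidPr eqP) -[in LHS]S2.
by rewrite eqEcard finset.subsetIr.
Qed.

Definition bad_set G (S : {set X}) : bool := (#|Lambda2 G S| < #|S|)%N.

(** For a pair, [Lambda2 G S] is the set of common neighbours, a [p ^+ 2]-random subset of [Y]; the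
    pair is bad when this set has at most one element. *)
Lemma Pr_bad_pair p (S : {set X}) : #|S| = 2%N -> (0 < #|Y|)%N ->
  Ebern p (fun G => (bad_set G S)%:R) =
  (1 - p ^+ 2) ^+ #|Y|.-1 * (1 + #|Y|.-1%:R * p ^+ 2).
Proof.
move=> S2 Y0; rewrite -cardsT -Ebern_card_le1 ?cardsT//.
rewrite -(@Ebern_pushforward p _ (fun A => S \subset A)); last first.
  by rewrite Ebern_subset S2.
apply: eq_Ebern => G; rewrite finset.setIT /bad_set S2 ltnS Lambda2_column.
congr (nat_of_bool (_ <= _)%N)%:R.
by apply: eq_card => y; rewrite !inE card_setI2.
Qed.

(* Chernoff bound: [bad_set G S && bad_set G S'] implies
   [1 <= 64 * (1/8) ^ (#|Lambda2 G S| + #|Lambda2 G S'|)]. *)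
Lemma Pr_bad_pair2 p (S S' : {set X}) : 0 <= p <= 1 ->
  #|S| = 2%N -> #|S'| = 2%N -> #|S :&: S'| = 1%N ->
  Ebern p (fun G => (bad_set G S && bad_set G S')%:R) <=
  64 * (1 - 7 / 4 * p ^+ 2 + 49 / 64 * p ^+ 3) ^+ #|Y|.
Proof.
move=> p01 S2 S'2 SS'.
pose z (b : bool) : R := 1 - 7 / 8 * b%:R.
pose f (y : Y) (A : {set X}) : R := z (S \subset A) * z (S' \subset A).
have <- : \prod_(y : Y) Ebern p (f y) =
    (1 - 7 / 4 * p ^+ 2 + 49 / 64 * p ^+ 3) ^+ #|Y|.
  rewrite -prodr_const; apply: eq_bigr => y _.
  (* Expand the product of the two weights; [S :|: S'] has three elements, whence [p ^+ 3]. *)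
  have -> : 1 - 7 / 4 * p ^+ 2 + 49 / 64 * p ^+ 3 =
      Ebern p (fun _ : {set X} => 1) - 7 / 8 * p ^+ #|S| -
      7 / 8 * p ^+ #|S'| + 49 / 64 * p ^+ #|S :|: S'|.
    by rewrite Ebern1 cardsU SS' S2 S'2 /=; field.
  rewrite -!Ebern_subset -!EbernZ -!EbernB -EbernD.
  apply: eq_Ebern => A; rewrite /f /z finset.subUset.
  by case: (S \subset A); case: (S' \subset A) => /=; field.
rewrite -Ebern_columns -EbernZ; apply: Ebern_le => // G.
have zprod (Q : {set X}) : #|Q| = 2%N -> bad_set G Q ->
    8^-1 <= \prod_y z (Q \subset column G y).
  move=> Q2; rewrite /bad_set Q2 Lambda2_column => hQ.
  pose L := [set y | Q \subset column G y].
  have -> : \prod_y z (Q \subset column G y) = 8^-1 ^+ #|L|.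
    rewrite -prodr_const [RHS]big_mkcond /=; apply: eq_bigr => y _.
    by rewrite inE /z; case: ifP => _ /=; field.
  have {hQ} : (#|L| <= 1)%N.
    rewrite -ltnS (leq_trans _ hQ)// ltnS; apply: subset_leq_card.
    by apply/fintype.subsetP => y; rewrite !inE card_setI2.
  by case: #|L| => [|[|]]// _; rewrite ?expr0 ?expr1//; lra.
have z0 b : 0 <= z b by rewrite /z; case: b => /=; lra.
rewrite /f big_split /=.
case: (boolP (bad_set G S && bad_set G S')) => [/andP[hS hS']|_] /=; last first.
  by rewrite mulr_ge0// mulr_ge0// prodr_ge0.
have := ler_pM _ _ (zprod _ S2 hS) (zprod _ S'2 hS').
by rewrite invr_ge0 => /(_ (ler0n _ _) (ler0n _ _)); lra.
Qed.

Lemma exists_subset_card (A : {set Y}) k : (k <= #|A|)%N ->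
  exists2 B : {set Y}, B \subset A & #|B| = k.
Proof.
case/card_geqP => s [us sk sA]; exists [set y in s].
  by apply/fintype.subsetP => y; rewrite inE => /sA.
by rewrite -sk; apply/eqP; rewrite cardsE; apply/eqP/card_uniqP.
Qed.

(* If [S] is bad, some [#|Y| - m] vertices of [Y] have at most one neighbour
   in [S]. *)
Lemma Pr_bad_set p m (S : {set X}) : 0 <= p <= 1 -> #|S| = m.+1 ->
    (m <= #|Y|)%N ->
  Ebern p (fun G => (bad_set G S)%:R) <=
  'C(#|Y|, m)%:R * ((1 - p) ^+ m * (1 + m%:R * p)) ^+ (#|Y| - m).
Proof.
move=> p01 Sm mY.
pose f (K : {set Y}) (y : Y) (A : {set X}) : R :=
  if y \in K then (#|A :&: S| <= 1)%:R else 1.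
have fE (K : {set Y}) : Ebern p (fun G => \prod_y f K y (column G y)) =
    ((1 - p) ^+ m * (1 + m%:R * p)) ^+ #|K|.
  rewrite Ebern_columns -prodr_const [RHS]big_mkcond; apply: eq_bigr => y _.
  rewrite /f; case: (y \in K); last exact: Ebern1.
  by rewrite Ebern_card_le1 Sm.
(* Union bound over the sets [K] of size [#|Y| - m], counted by their complements. *)
have -> : 'C(#|Y|, m)%:R * ((1 - p) ^+ m * (1 + m%:R * p)) ^+ (#|Y| - m) =
  \sum_(K in [set K : {set Y} | #|K| == (#|Y| - m)%N])
     Ebern p (fun G => \prod_y f K y (column G y)).
  rewrite -bin_sub// -card_draws mulr_natl -sumr_const.
  by apply: eq_bigr => K; rewrite inE fE => /eqP ->.
rewrite -Ebern_sum; apply: Ebern_le => // G.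
have f0 K : 0 <= \prod_y f K y (column G y).
  by apply: prodr_ge0 => y _; rewrite /f; case: ifP.
case: (boolP (bad_set G S)) => [|_] /=; last by rewrite sumr_ge0.
rewrite /bad_set Lambda2_column Sm ltnS => hS.
have [K KL Kc] : exists2 K : {set Y},
    K \subset ~: [set y | (2 <= #|column G y :&: S|)%N] & #|K| = (#|Y| - m)%N.
  by apply: exists_subset_card; rewrite cardsCs finset.setCK leq_sub2l.
rewrite (bigD1 K) ?inE ?Kc//= -[leLHS]addr0 lerD ?sumr_ge0//.
rewrite big1// => y _; rewrite /f; case: ifP => // yK.
by have := fintype.subsetP KL _ yK; rewrite !inE -leqNgt => ->.
Qed.

(** Whether [S] is bad depends only on the pairs with first component in [S], and the sets in [s]
    use none of these. *)
Lemma bad_set_indep p (S : {set X}) (s : seq {set X}) :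
  all (fun S' : {set X} => [disjoint S & S']) s ->
  Ebern p (fun G => (bad_set G S && all (fun S' => ~~ bad_set G S') s)%:R) =
  Ebern p (fun G => (bad_set G S)%:R) *
  Ebern p (fun G => (all (fun S' => ~~ bad_set G S') s)%:R).
Proof.
move=> sS; rewrite -(@Ebern_indep _ _ p [set u | u.1 \in S]).
- by apply: eq_Ebern => G; rewrite -natrM mulnb.
- move=> G G' /setP GG'; congr (nat_of_bool (_ < _)%N)%:R.
  rewrite !Lambda2_column; apply: eq_card => y; rewrite !inE; congr (_ <= _)%N.
  apply: eq_card => x; rewrite !inE.
  by have := GG' (x, y); rewrite !inE /=.
- move=> G G' /setP GG'; congr (nat_of_bool _)%:R.
  apply: eq_in_all => S' /(allP sS) dS; congr (~~ (_ < _)%N).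
  rewrite !Lambda2_column; apply: eq_card => y; rewrite !inE; congr (_ <= _)%N.
  apply: eq_card => x; rewrite !inE.
  case xS' : (x \in S'); rewrite ?andbF// !andbT.
  have := GG' (x, y); rewrite !inE /=.
  by rewrite (disjointFl dS xS').
Qed.

End Columns.

(** * Sieving events along a dependency relation *)

Section Sieve.
Variables (R : realType) (T : finType) (I : eqType).
Variables (p : R) (B : I -> pred {set T}) (dep : rel I).
Hypothesis p01 : 0 <= p <= 1.

Let Pr (E : pred {set T}) := Ebern p (fun G => (E G)%:R).
Let none s : pred {set T} := fun G => all (fun i => ~~ B i G) s.

Hypothesis indep : forall i s,
  all (fun j => ~~ dep i j) s ->
  Pr (fun G => B i G && none s G) = Pr (B i) * Pr (none s).

(** If no kept event occurs, then either no event of [s] occurs or a discarded one does. It is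
    applied with [b] equal to [B i G] and to [true]. *)
Let none_filter (b : bool) (d : pred I) s G :
  (b && none [seq j <- s | ~~ d j] G)%:R <=
  (b && none s G)%:R + \sum_(j <- s | d j) (b && B j G)%:R :> R.
Proof.
case: b; last by rewrite addr_ge0// sumr_ge0.
elim: s => [|j s IH]; first by rewrite big_nil addr0.
have s0 : 0 <= \sum_(j <- s | d j) (true && B j G)%:R :> R by rewrite sumr_ge0.
rewrite big_cons /= /none /=; case: (d j); case Bj: (B j G); rewrite /= ?Bj //=.
- by rewrite add0r -[leLHS]addr0 lerD// ler_nat; case: (all _ _).
- by rewrite add0r; exact: IH.
- by rewrite add0r.
Qed.

Let Pr_ge0 E : 0 <= Pr E.
Proof.
by apply: sumr_ge0 => G _; rewrite mulr_ge0// bern_ge0.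
Qed.

Let Pr_le (E E' : pred {set T}) : (forall G, E G -> E' G) -> Pr E <= Pr E'.
Proof.
move=> EE'; apply: Ebern_le => // G; rewrite ler_nat.
by case: (E G) (EE' G) => // ->.
Qed.

Let Pr_le1 E : Pr E <= 1.
Proof.
by rewrite -(@Ebern1 R T p); apply: Ebern_le => // G; case: (E G).
Qed.

(* Without the events depending on [B i], the condition [none s] would be
   independent of [B i]; dropping them costs at most the right-hand side. *)
Let none_step i s :
  `|Pr (none (i :: s)) - (1 - Pr (B i)) * Pr (none s)| <=
  \sum_(j <- s | dep i j) (Pr (fun G => B i G && B j G) + Pr (B i) * Pr (B j)).
Proof.
pose s' := [seq j <- s | ~~ dep i j].
have sub G : none s G -> none s' G.
  by rewrite /none /s' all_filter; apply: sub_all => j /= ->; rewrite implybT.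
have -> : Pr (none (i :: s)) = Pr (none s) - Pr (fun G => B i G && none s G).
  rewrite /Pr -EbernB; apply: eq_Ebern => G; rewrite /none /=.
  by case: (B i G); rewrite /= ?subrr ?subr0.
have ind : Pr (fun G => B i G && none s' G) = Pr (B i) * Pr (none s').
  by apply: indep; rewrite /s' all_filter; apply/allP => j _; apply/implyP.
have h1 : Pr (fun G => B i G && none s G) <= Pr (B i) * Pr (none s').
  by rewrite -ind; apply: Pr_le => G /andP[-> /sub].
have h2 : Pr (B i) * Pr (none s') <= Pr (fun G => B i G && none s G) +
    \sum_(j <- s | dep i j) Pr (fun G => B i G && B j G).
  rewrite -ind /Pr -Ebern_sum -EbernD; apply: Ebern_le => // G.
  exact: none_filter.
have h3 : Pr (none s) <= Pr (none s') by apply: Pr_le.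
have h4 : Pr (none s') <= Pr (none s) + \sum_(j <- s | dep i j) Pr (B j).
  rewrite /Pr -Ebern_sum -EbernD; apply: Ebern_le => // G.
  exact: (none_filter true).
rewrite big_split /= -mulr_sumr.
have := ler_wpM2l (Pr_ge0 (B i)) h3; have := ler_wpM2l (Pr_ge0 (B i)) h4.
have : 0 <= \sum_(j <- s | dep i j) Pr (fun G => B i G && B j G).
  by rewrite sumr_ge0.
have : 0 <= Pr (B i) * \sum_(j <- s | dep i j) Pr (B j).
  by rewrite mulr_ge0// sumr_ge0.
rewrite ler_norml; lra.
Qed.

(** Induction on [s]: a new event costs the error of [none_step], and the earlier error is
    multiplied by [1 - Pr (B i)], which is in [0, 1]. Counting ordered pairs on the right only adds
    nonnegative terms. *)
Lemma dependency_sieve s : uniq s ->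
  `|Pr (none s) - \prod_(i <- s) (1 - Pr (B i))| <=
  \sum_(i <- s) \sum_(j <- s | dep i j && (j != i))
     (Pr (fun G => B i G && B j G) + Pr (B i) * Pr (B j)).
Proof.
have t0 i j : 0 <= Pr (fun G => B i G && B j G) + Pr (B i) * Pr (B j).
  by rewrite addr_ge0// mulr_ge0.
elim: s => [_|i s IH /=].
  by rewrite !big_nil /none /Pr Ebern1 subrr normr0.
case/andP=> si us; rewrite !big_cons eqxx andbF.
rewrite -(subrK ((1 - Pr (B i)) * Pr (none s)) (Pr (none (i :: s)))) -addrA.
apply: le_trans (ler_normD _ _) _; apply: lerD.
  apply: le_trans (none_step _ _) _; rewrite le_eqVlt; apply/orP; left; apply/eqP.
  rewrite [LHS]big_seq_cond [RHS]big_seq_cond; apply: eq_bigl => j.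
  case js : (j \in s) => //=; suff -> : j != i by rewrite andbT.
  by apply: contraNneq si => <-.
rewrite -mulrBr normrM.
apply: (@le_trans _ _ (`|Pr (none s) - \prod_(i <- s) (1 - Pr (B i))|)).
  by rewrite ler_piMl// ler_norml; have := Pr_ge0 (B i); have := Pr_le1 (B i); lra.
apply: le_trans (IH us) _; apply: ler_sum => k _; rewrite big_cons.
by case: ifP => // _; rewrite lerDr.
Qed.

End Sieve.

(** * Reduction of the double Hall property to bad pairs *)

Section DoubleHall.
Variables (R : realType) (n : nat).
Implicit Types (p : R) (G : bigraph 'I_n 'I_n).

Definition pair_prob p : R := (1 - p ^+ 2) ^+ n.-1 * (1 + n.-1%:R * p ^+ 2).

Definition two_pairs_bound p : R :=
  64 * (1 - 7 / 4 * p ^+ 2 + 49 / 64 * p ^+ 3) ^+ n.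

(* Union bound for the sets [S] of size [m.+1]; note the shift. *)
Definition large_set_bound p (m : nat) : R :=
  'C(n, m.+1)%:R * ('C(n, m)%:R * ((1 - p) ^+ m * (1 + m%:R * p)) ^+ (n - m)).

Lemma Gnnp_PrE p (A : pred (bigraph 'I_n 'I_n)) :
  Gnnp_Pr p A = Ebern p (fun G => (A G)%:R).
Proof.
rewrite /Gnnp_Pr big_mkcond; apply: eq_bigr => G _.
by case: (A G); rewrite ?mulr1 ?mulr0.
Qed.

Lemma Lambda2U G H (S : {set 'I_n}) : Lambda2 G S \subset Lambda2 (G :|: H) S.
Proof.
apply/fintype.subsetP => y; rewrite !inE => /leq_trans; apply.
apply: subset_leq_card; apply/fintype.subsetP => x; rewrite !inE.
by case/andP=> -> ->.
Qed.

Lemma Gnnp_double_Hall_mono p q : 0 <= p -> p <= q -> q <= 1 ->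
  Gnnp_Pr p (@double_Hall 'I_n 'I_n) <= Gnnp_Pr q (@double_Hall 'I_n 'I_n).
Proof.
move=> p0 pq q1; rewrite !Gnnp_PrE; apply: Ebern_mono => // G H.
rewrite ler_nat /double_Hall; case: (2 <= _)%N => //=.
case: forallP => // hG; rewrite lt0b; apply/forallP => S; apply/implyP => S2.
have := hG S; rewrite S2 => /leq_trans; apply; exact/subset_leq_card/Lambda2U.
Qed.

Lemma double_HallE G : (2 <= n)%N ->
  double_Hall G = [forall S : {set 'I_n}, (2 <= #|S|)%N ==> ~~ bad_set G S].
Proof.
move=> n2; rewrite /double_Hall card_ord n2 /=.
by apply: eq_forallb => S; rewrite /bad_set -leqNgt.
Qed.

Definition pairs : seq {set 'I_n} := enum [set S : {set 'I_n} | #|S| == 2%N].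

Definition no_bad_pair G := all (fun S => ~~ bad_set G S) pairs.

(** A pair meeting [S] is the image [[set x; y]] of some [(x, y)] with [x] in [S] and [y]
    arbitrary. *)
Lemma card_pairs_meeting (S : {set 'I_n}) : #|S| = 2%N ->
  (#|[set S' : {set 'I_n} | (#|S'| == 2) && ~~ [disjoint S & S']]| <= 2 * n)%N.
Proof.
move=> S2; have <- : #|finset.setX S [set: 'I_n]| = (2 * n)%N.
  by rewrite cardsX S2 cardsT card_ord.
apply: leq_trans (leq_imset_card (fun u : 'I_n * 'I_n => [set u.1; u.2]) _).
apply: subset_leq_card; apply/fintype.subsetP => S'.
rewrite inE => /andP[/cards2P[x [y [xy ->]]]].
rewrite -setI_eq0 => /set0Pn[z]; rewrite !inE => /andP[zS /orP[/eqP zx|/eqP zy]].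
  by apply/imsetP; exists (x, y); rewrite // !inE -zx zS.
by apply/imsetP; exists (y, x); [rewrite !inE -zy zS|exact: finset.setUC].
Qed.

Lemma card_setI1 (S S' : {set 'I_n}) : #|S| = 2%N -> #|S'| = 2%N ->
  ~~ [disjoint S & S'] -> S' != S -> #|S :&: S'| = 1%N.
Proof.
move=> S2 S'2; rewrite -setI_eq0 -cards_eq0 -lt0n => h1 nSS.
apply/eqP; rewrite eqn_leq h1 andbT -ltnS leqNgt; apply: contra nSS => h2.
rewrite eq_sym eqEcard S2 S'2 andbT; apply/finset.setIidPl/eqP.
by rewrite eqEcard finset.subsetIl S2.
Qed.

(** [dependency_sieve], with pairs dependent when they meet: each of the ['C(n, 2)] pairs meets at
    most [2 * n] pairs, so the error has at most [n ^ 3] terms. *)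
Lemma no_bad_pair_approx p : (2 <= n)%N -> 0 <= p <= 1 ->
  `|Ebern p (fun G => (no_bad_pair G)%:R) - (1 - pair_prob p) ^+ 'C(n, 2)| <=
  n%:R ^+ 3 * (two_pairs_bound p + pair_prob p ^+ 2).
Proof.
move=> n2 p01.
have n0 : (0 < n)%N by apply: leq_trans n2.
have pairsP S : (S \in pairs) = (#|S| == 2%N) by rewrite mem_enum inE.
have size_pairs : size pairs = 'C(n, 2).
  by rewrite -cardE card_draws card_ord.
have prE S : S \in pairs -> Ebern p (fun G => (bad_set G S)%:R) = pair_prob p.
  by rewrite pairsP => /eqP S2; rewrite Pr_bad_pair// card_ord.
have prodE : \prod_(S <- pairs) (1 - Ebern p (fun G => (bad_set G S)%:R)) =
    (1 - pair_prob p) ^+ 'C(n, 2).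
  rewrite big_seq (eq_bigr (fun=> 1 - pair_prob p)) => [|S Sp]; last by rewrite prE.
  by rewrite -big_seq big_const_seq count_predT size_pairs iter_mulr_1.
rewrite -prodE; apply: le_trans.
  apply: (@dependency_sieve R _ _ p (fun S G => bad_set G S)
    (fun S S' : {set 'I_n} => ~~ [disjoint S & S']) p01 _ pairs (enum_uniq _)).
  by move=> S s; rewrite (eq_all (fun S' => negbK _)); exact: bad_set_indep.
set e := two_pairs_bound p + _.
have e0 : 0 <= e.
  rewrite addr_ge0 ?sqr_ge0//.
  rewrite /two_pairs_bound mulr_ge0// exprn_ge0//.
  (* In this form the base is visibly nonnegative on [0, 1]. *)
  have -> : 1 - 7 / 4 * p ^+ 2 + 49 / 64 * p ^+ 3 =
    (1 - p) + p * (1 - 7 / 8 * p) ^+ 2 by field.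
  move: p01 => /andP[p0 p1].
  by apply: addr_ge0; [rewrite subr_ge0|rewrite mulr_ge0 ?sqr_ge0].
apply: (@le_trans _ _ (\sum_(S <- pairs) (2 * n)%:R * e)).
  rewrite big_seq [leRHS]big_seq; apply: ler_sum => S; rewrite pairsP => /eqP S2.
  apply: (@le_trans _ _ (\sum_(S' <- pairs | ~~ [disjoint S & S'] && (S' != S)) e)).
    rewrite big_seq_cond [leRHS]big_seq_cond; apply: ler_sum => S'.
    case/andP=> S'p /andP[dS nS]; move: (S'p); rewrite pairsP => /eqP S'2.
    rewrite !prE ?pairsP ?S2 ?S'2// /e; apply: lerD; last by rewrite expr2.
    rewrite /two_pairs_bound -[n in leRHS]card_ord.
    exact/Pr_bad_pair2/card_setI1.
  rewrite big_const_seq iter_addr_0 -[e *+ _]mulr_natl ler_wpM2r// ler_nat.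
  apply: leq_trans (card_pairs_meeting S2).
  rewrite -size_filter -(card_uniqP _); last by apply: filter_uniq; exact: enum_uniq.
  apply: subset_leq_card; apply/fintype.subsetP => S'.
  by rewrite mem_filter pairsP inE => /andP[/andP[-> _] ->].
rewrite big_const_seq iter_addr_0 count_predT size_pairs -[_ * e *+ _]mulr_natl mulrA.
rewrite ler_wpM2r// -natrM -natrX ler_nat bin2.
apply: leq_trans (_ : (n * n.-1)./2.*2 * n <= _)%N; first by rewrite -muln2; lia.
by rewrite !expnS expn0; have := odd_double_half (n * n.-1); nia.
Qed.

(** The left-hand side is the expected number of bad sets with at least three elements; it is split
    by cardinality. *)
Lemma Pr_bad_large p : 0 <= p <= 1 ->
  Ebern p (fun G => \sum_(S : {set 'I_n} | (3 <= #|S|)%N) (bad_set G S)%:R) <=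
  \sum_(m < n | (2 <= m)%N) large_set_bound p m.
Proof.
move=> p01; rewrite Ebern_sum.
pose c (S : {set 'I_n}) : 'I_n.+1 := inord #|S|.
have cE S : c S = #|S| :> nat.
  by rewrite inordK// ltnS (leq_trans (max_card _))// card_ord.
rewrite (partition_big c (fun k => (3 <= k)%N)) /=; last by move=> S; rewrite cE.
(* Cardinality 0 contributes nothing; dropping it makes [m] stand for cardinality [m.+1]. *)
rewrite big_mkcond big_ord_recl /= add0r [leRHS]big_mkcond; apply: ler_sum => m _.
rewrite /bump /= add1n ltnS; case: ifP => // m2.
have -> : large_set_bound p m = \sum_(S in [set S : {set 'I_n} | #|S| == m.+1])
   ('C(n, m)%:R * ((1 - p) ^+ m * (1 + m%:R * p)) ^+ (n - m)).
  by rewrite sumr_const card_draws card_ord -[RHS]mulr_natl.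
rewrite [leRHS](eq_bigl (fun S : {set 'I_n} => (2 < #|S|)%N && (c S == lift ord0 m))).
  apply: ler_sum => S /andP[_ /eqP cm].
  have := cE S; rewrite cm /= /bump /= add1n => /esym Sm.
  have := @Pr_bad_set R _ 'I_n p m S p01 Sm; rewrite card_ord; apply.
  exact: ltnW.
move=> S; rewrite inE -val_eqE /= cE /bump /= add1n; case: eqP => [->|]; last first.
  by rewrite andbF.
by rewrite ltnS m2.
Qed.

(** The double Hall property implies [no_bad_pair]; when only the latter holds, some set of size at
    least 3 is bad. *)
Lemma double_Hall_approx p : (2 <= n)%N -> 0 <= p <= 1 ->
  `|Gnnp_Pr p (@double_Hall 'I_n 'I_n) - (1 - pair_prob p) ^+ 'C(n, 2)| <=
  n%:R ^+ 3 * (two_pairs_bound p + pair_prob p ^+ 2) +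
  \sum_(m < n | (2 <= m)%N) large_set_bound p m.
Proof.
move=> n2 p01.
rewrite Gnnp_PrE -(subrK (Ebern p (fun G => (no_bad_pair G)%:R)) (Ebern _ _)).
rewrite -addrA addrC; apply: le_trans (ler_normD _ _) (lerD _ _).
  exact: no_bad_pair_approx.
apply: le_trans (Pr_bad_large p01).
have h1 : Ebern p (fun G => (double_Hall G)%:R) <=
    Ebern p (fun G => (no_bad_pair G)%:R).
  apply: Ebern_le => // G; rewrite ler_nat; case dH: (double_Hall G) => //.
  rewrite lt0b; apply/allP => S; rewrite mem_enum inE => /eqP S2.
  by move: dH; rewrite double_HallE// => /forallP/(_ S); rewrite S2.
rewrite distrC ger0_norm ?subr_ge0// lerBlDr -EbernD.
apply: Ebern_le => // G; case: (boolP (no_bad_pair G)) => [/allP nb|_]; last first.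
  by rewrite addr_ge0// sumr_ge0.
have [|dH] := boolP (double_Hall G); first by rewrite lerDr sumr_ge0.
move: dH; rewrite double_HallE// negb_forall => /existsP[S].
rewrite negb_imply negbK => /andP[S2 bS].
have S3 : (3 <= #|S|)%N.
  rewrite ltn_neqAle S2 andbT; apply: contraL bS => S2'.
  by apply: nb; rewrite mem_enum inE eq_sym.
by rewrite (bigD1 S)//= bS addr0 lerDl sumr_ge0.
Qed.

End DoubleHall.

(** * Large sets *)

Section Inequalities.
Variable R : realType.
Implicit Types (x p : R).

Lemma expR_ge_taylor2 x : 0 <= x -> 1 + x + x ^+ 2 / 2 <= expR x.
Proof.
move=> x0.
have -> : 1 + x + x ^+ 2 / 2 = series (exp_coeff x) 3%N.
  rewrite /series /= !big_nat_recr ?big_geq//= /exp_coeff /=.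
  by rewrite !factS fact0 expr0 expr1; field.
apply: nondecreasing_cvgn_le; last exact: is_cvg_series_exp_coeff.
apply: nondecreasing_series => i _ _; exact: exp_coeff_ge0.
Qed.

Lemma onem_le_expRN x : 1 - x <= expR (- x).
Proof. exact: expR_ge1Dx. Qed.

(** After inversion, the Taylor bound at [y = x + x^2] reduces this to the polynomial inequality
    [1 <= (1 + y + y^2 / 2) (1 - x)]. *)
Lemma expRN_le_onem x : 0 <= x -> x <= 1 / 3 -> expR (- (x + x ^+ 2)) <= 1 - x.
Proof.
move=> x0 x1.
rewrite expRN -[leRHS]invrK lef_pV2 ?posrE ?expR_gt0 ?invr_gt0; [|lra|lra].
have y0 : 0 <= x + x ^+ 2 by nra.
apply: le_trans (expR_ge_taylor2 y0).
have x10 : 0 < 1 - x by lra.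
rewrite -[leLHS]mul1r ler_pdivrMr//.
have : 0 <= x ^+ 2 * (1 / 3 - x) by rewrite mulr_ge0 ?sqr_ge0//; lra.
have : 0 <= x ^+ 3 by rewrite exprn_ge0.
have : 0 <= x ^+ 4 * (1 / 3 - x) by rewrite mulr_ge0 ?exprn_ge0//; lra.
have : 0 <= x ^+ 3 * (1 / 3 - x) by rewrite mulr_ge0 ?exprn_ge0//; lra.
lra.
Qed.

(** This amounts to [x - ln (1 + x) >= x^2 / 2 - x^3], which is sharp to second order near 0. *)
Lemma oneD_le_expR x : 0 <= x -> 1 + x <= expR (x - x ^+ 2 / 2 + x ^+ 3).
Proof.
move=> x0.
have y0 : 0 <= x - x ^+ 2 / 2 + x ^+ 3.
  have -> : x - x ^+ 2 / 2 + x ^+ 3 = x * ((x - 1 / 4) ^+ 2 + 15 / 16) by field.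
  by rewrite mulr_ge0// addr_ge0 ?sqr_ge0//; lra.
apply: le_trans (expR_ge_taylor2 y0).
have -> : 1 + (x - x ^+ 2 / 2 + x ^+ 3) + (x - x ^+ 2 / 2 + x ^+ 3) ^+ 2 / 2 =
  1 + x + (x ^+ 3 / 2 + x ^+ 4 / 2 * ((x - 1 / 2) ^+ 2 + 2)) by field.
rewrite lerDl addr_ge0// ?divr_ge0 ?exprn_ge0// mulr_ge0 ?divr_ge0 ?exprn_ge0//.
by rewrite addr_ge0 ?sqr_ge0.
Qed.

(** At [x = 1 / 100] the gain [x^2 / 2] is [x / 200], so the rate [1 / 400] leaves a factor of about
    two. *)
Lemma oneD_le_expR_lin x : 1 / 100 <= x -> 1 + x <= expR (x - x / 400).
Proof.
move=> x1; have y0 : 0 <= x - x / 400 by lra.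
apply: le_trans (expR_ge_taylor2 y0); nra.
Qed.

Lemma expn_onem_le (m : nat) p : 0 <= p <= 1 ->
  (1 - p) ^+ m <= expR (- (m%:R * p)).
Proof.
move=> /andP[p0 p1]; rewrite -mulrN expRM_natl lerXn2r ?nnegrE ?expR_ge0//.
  by rewrite subr_ge0.
exact: onem_le_expRN.
Qed.

Lemma le_bin_exp (n m : nat) : ('C(n, m) <= n ^ m)%N.
Proof.
have [n0|n0] := posnP n.
  by rewrite n0 bin0n; case: m => // m; rewrite eqn0Ngt.
apply: (@leq_trans (n ^_ m)); first by rewrite -bin_ffact leq_pmulr// fact_gt0.
elim: m => [|m IH]; first by rewrite ffactn0.
by rewrite ffactnSr expnSr leq_mul// leq_subr.
Qed.

Lemma natr_expR_ln (n : nat) : (0 < n)%N -> n%:R = expR (ln n%:R) :> R.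
Proof. by move=> n0; rewrite lnK// posrE ltr0n. Qed.

Lemma bin_le_expR (n m : nat) : (0 < n)%N ->
  'C(n, m)%:R <= expR (m%:R * ln n%:R) :> R.
Proof.
by move=> n0; rewrite expRM_natl -natr_expR_ln// -natrX ler_nat le_bin_exp.
Qed.

(** [a] and [b] are the entropies of the choices in [X] and [Y], and [h] is the gain from each of
    the [n - m] vertices of [Y]. *)
Lemma large_set_bound_le (n m : nat) p (h a b : R) : (0 < n)%N -> 0 <= p <= 1 ->
  (1 - p) ^+ m * (1 + m%:R * p) <= expR (- h) ->
  'C(n, m.+1)%:R <= expR a -> 'C(n, m)%:R <= expR b ->
  large_set_bound n p m <= expR (a + b - (n - m)%:R * h).
Proof.
move=> n0 /andP[p0 p1] hq ha hb; rewrite -addrA !expRD -mulrN expRM_natl.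
have q0 : 0 <= (1 - p) ^+ m * (1 + m%:R * p).
  have p1' : 0 <= 1 - p by rewrite subr_ge0.
  by apply: mulr_ge0; [exact: exprn_ge0|rewrite addr_ge0// mulr_ge0].
rewrite /large_set_bound ler_pM ?mulr_ge0 ?exprn_ge0//.
by rewrite ler_pM ?exprn_ge0// lerXn2r ?nnegrE ?expR_ge0.
Qed.

(* [p <= 1 / 1800] turns [2 * ln n <= n * p ^+ 2] into [3600 * ln n <= n * p],
   which beats the entropy of the choice of large sets. *)
Definition sparse_range (n : nat) p : Prop :=
  [/\ (100 <= n)%N, 0 < p <= 1 / 1800, 1 <= ln n%:R :> R
    & 2 * ln n%:R <= n%:R * p ^+ 2].

(** For triples the base is exactly [1 - 3 p^2 + 2 p^3]: the entropy [5 ln n] meets a gain of about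
    [3 n p^2 >= 6 ln n]. The general exponent [n (m p)^2 / 2] would guarantee only [4 ln n]. *)
Lemma large_set_bound2 n p : sparse_range n p ->
  large_set_bound n p 2 <= expR (- (ln n%:R / 2)).
Proof.
case=> n100 /andP[p0 p1]; set L : R := ln n%:R => L1 npL.
have n0 : (0 < n)%N by apply: leq_trans n100.
have nr100 : 100 <= n%:R :> R by rewrite (ler_nat _ 100).
have p01 : 0 <= p <= 1 by apply/andP; split; lra.
apply: (@le_trans _ _
  (expR (3 * L + 2 * L - (n - 2)%:R * (3 * p ^+ 2 - 2 * p ^+ 3)))).
  apply: large_set_bound_le => //; try exact: bin_le_expR.
  apply: le_trans (onem_le_expRN _); rewrite le_eqVlt; apply/orP; left.
  by apply/eqP; ring.
rewrite ler_expR natrB; last by apply: leq_trans n100.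
set N : R := n%:R in npL nr100 *.
have h1 : 98 / 100 * N <= N - 2 by lra.
have h2 : (5 / 2 + 9 / 20) * p ^+ 2 <= 3 * p ^+ 2 - 2 * p ^+ 3.
  have -> : 3 * p ^+ 2 - 2 * p ^+ 3 = (3 - 2 * p) * p ^+ 2 by ring.
  by rewrite ler_wpM2r ?sqr_ge0//; lra.
have h3 : 98 / 100 * N * ((5 / 2 + 9 / 20) * p ^+ 2) <=
    (N - 2) * (3 * p ^+ 2 - 2 * p ^+ 3).
  apply: ler_pM => //; first lra.
  by rewrite mulr_ge0 ?sqr_ge0//; lra.
lra.
Qed.

(** The bound [n^(-3/2)] can be summed over fewer than [n] values of [m]. There are three ranges:
    [m p < 1 / 100], then [m <= n - m], then [m > n - m]. *)
Lemma large_set_bound3 n p m : sparse_range n p -> (3 <= m < n)%N ->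
  large_set_bound n p m <= expR (- (3 / 2 * ln n%:R)).
Proof.
case=> n100 /andP[p0 p1]; set L : R := ln n%:R => L1 npL.
have n0 : (0 < n)%N by apply: leq_trans n100.
have nr100 : 100 <= n%:R :> R by rewrite (ler_nat _ 100).
have p01 : 0 <= p <= 1 by apply/andP; split; lra.
have npL1 : 3600 * L <= n%:R * p.
  have : n%:R * p * p <= n%:R * p * (1 / 1800).
    by rewrite ler_wpM2l// mulr_ge0// ltW.
  by move: npL; rewrite expr2; lra.
move=> /andP[m3 mn]; set x := m%:R * p.
have x0 : 0 <= x by rewrite mulr_ge0// ltW.
have qexp y : 1 + x <= expR (x - y) ->
    (1 - p) ^+ m * (1 + m%:R * p) <= expR (- y).
  move=> hy; have -> : - y = - x + (x - y) by ring.
  have p1' : 0 <= 1 - p by lra.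
  by rewrite expRD; apply: ler_pM; rewrite ?exprn_ge0 ?expn_onem_le// addr_ge0.
have m3r : 3 <= m%:R :> R by rewrite (ler_nat _ 3).
(* For small [x] the quadratic term of [x - ln (1 + x)] is needed; for large
   [x] a linear lower bound is enough. *)
have [x1|x1] := leP (1 / 100) x; last first.
  apply: (@le_trans _ _
     (expR (m.+1%:R * L + m%:R * L - (n - m)%:R * (x ^+ 2 / 2 - x ^+ 3)))).
    apply: large_set_bound_le => //; try exact: bin_le_expR.
    by apply: qexp; rewrite opprB addrA addrAC; exact: oneD_le_expR.
  rewrite ler_expR natrB; last exact: ltnW.
  rewrite -natr1; move: npL nr100 npL1 m3r x0 x1; rewrite /x.
  set N : R := n%:R; set M : R := m%:R => H1 H2 H3 H4 H5 H6.
  have h1 : 99 / 100 * N <= N - M.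
    suff : M <= N / 100 by lra.
    have : p * M <= p * (N / 100) by lra.
    by rewrite ler_pM2l.
  have h2 : 49 / 100 * (M * p) ^+ 2 <= (M * p) ^+ 2 / 2 - (M * p) ^+ 3.
    have -> : (M * p) ^+ 2 / 2 - (M * p) ^+ 3 = (1 / 2 - M * p) * (M * p) ^+ 2 by ring.
    by rewrite ler_wpM2r ?sqr_ge0//; lra.
  have h3 : 99 / 100 * N * (49 / 100 * (M * p) ^+ 2) <=
      (N - M) * ((M * p) ^+ 2 / 2 - (M * p) ^+ 3).
    apply: ler_pM => //; first lra.
    by rewrite mulr_ge0 ?sqr_ge0//; lra.
  have h4 : M ^+ 2 * (2 * L) <= M ^+ 2 * (N * p ^+ 2) by rewrite ler_wpM2l ?sqr_ge0.
  (* The gain, at least [97 / 100 * M ^+ 2 * L], covers the entropy [(2 M + 1) L] and the claimed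
     [3 / 2 * L] as soon as [M >= 3]. *)
  have h5 : 0 <= L * (97 / 100 * M ^+ 2 - 2 * M - 5 / 2).
    by rewrite mulr_ge0; [|lra|nra].
  have : 99 / 100 * N * (49 / 100 * (M * p) ^+ 2) =
    (99 * 49 / 10000) * (M ^+ 2 * (N * p ^+ 2)) by field.
  have : 0 <= M ^+ 2 * L by rewrite mulr_ge0 ?sqr_ge0//; lra.
  lra.
have qh := qexp _ (oneD_le_expR_lin x1).
have t1 : 1 <= (n - m)%:R :> R by rewrite (ler_nat _ 1) subn_gt0.
have nE : n%:R = (n - m)%:R + m%:R :> R by rewrite -natrD subnK// ltnW.
have [mt|tm] := leP (m%:R : R) (n - m)%:R.
  (* Here [n - m >= n / 2], so the gain is at least [m p n / 800 >= 9 / 2 * m L]. *)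
  apply: (@le_trans _ _ (expR (m.+1%:R * L + m%:R * L - (n - m)%:R * (x / 400)))).
    by apply: large_set_bound_le => //; exact: bin_le_expR.
  rewrite ler_expR -natr1 /x; move: mt nE t1 m3r npL1.
  set N : R := n%:R; set M : R := m%:R; set t : R := (n - m)%:R => H1 H2 H3 H4 H5.
  have : M * (p * (N / 2)) <= M * (p * t) by rewrite !ler_pM2l//; lra.
  have : M * (3600 * L) <= M * (N * p) by rewrite ler_pM2l//; lra.
  have : L * 3 <= L * M by rewrite ler_pM2l//; lra.
  lra.
(* Now both binomials are counted by complements, with total entropy at most [2 (n - m) L]; since
   [m >= n / 2], the gain is at least [9 / 2 * (n - m) L]. *)
apply: (@le_trans _ _
  (expR ((n - m)%:R * L + (n - m)%:R * L - (n - m)%:R * (x / 400)))).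
  apply: large_set_bound_le => //.
    rewrite -bin_sub// (le_trans (bin_le_expR _ _))// ler_expR.
    by rewrite -/L ler_wpM2r ?ler_nat ?leq_sub2l//; lra.
  by rewrite -bin_sub ?(le_trans (bin_le_expR _ _))// ltnW.
rewrite ler_expR /x; move: tm nE t1 npL1.
set N : R := n%:R; set M : R := m%:R; set t : R := (n - m)%:R => H1 H2 H3 H4.
have : t * (p * (N / 2)) <= t * (p * M) by rewrite !ler_pM2l//; lra.
have : t * (3600 * L) <= t * (N * p) by rewrite ler_pM2l//; lra.
have : L * 1 <= L * t by rewrite ler_pM2l//; lra.
lra.
Qed.

Lemma sum_large_set_bound n p : sparse_range n p ->
  \sum_(m < n | (2 <= m)%N) large_set_bound n p m <= 2 * expR (- (ln n%:R / 2)).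
Proof.
move=> sr; have [n100 _ _ _] := sr.
have n0 : (0 < n)%N by apply: leq_trans n100.
have n2 : (2 < n)%N by apply: leq_trans n100.
rewrite (bigD1 (Ordinal n2))//= mulrDl mul1r lerD ?large_set_bound2//.
apply: (@le_trans _ _ (\sum_(m < n) expR (- (3 / 2 * ln n%:R)))).
  rewrite big_mkcond; apply: ler_sum => m _.
  case: ifP => [/andP[m2 mN]|_]; last exact: expR_ge0.
  apply: large_set_bound3 => //; rewrite ltn_ord andbT ltn_neqAle m2 andbT eq_sym.
  by move: mN; rewrite -val_eqE.
rewrite sumr_const card_ord -[_ *+ n]mulr_natl {1}(natr_expR_ln n0) -expRD ler_expR.
lra.
Qed.

End Inequalities.

Local Open Scope classical_set_scope.
Local Open Scope ring_scope.

(** * Asymptotics *)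

Section Limits.
Variable R : realType.
Implicit Types (u v b : nat -> R).

Lemma cvgy_ln u : u n @[n --> \oo] --> +oo -> ln (u n) @[n --> \oo] --> +oo.
Proof.
move=> /cvgryPge uy; apply/cvgryPge => A; near=> n.
have un : expR A <= u n by near: n; exact: uy.
by rewrite -[A]expRK ler_ln ?posrE ?expR_gt0// (lt_le_trans (expR_gt0 A)).
Unshelve. all: by end_near. Qed.

Lemma cvgy_inv u : u n @[n --> \oo] --> +oo -> (u n)^-1 @[n --> \oo] --> 0.
Proof.
move=> uy; apply/gtr0_cvgV0 => //.
by near=> n; near: n; move/cvgryPgt : uy; exact.
Unshelve. all: by end_near. Qed.

(** For small [b], [exp (- b (1 + b)) <= 1 - b <= exp (- b)]; after raising to the power [N], both
    bounds have the same limit. *)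
Lemma cvg_onem_expn b (N : nat -> nat) (l : R) :
  (\forall n \near \oo, 0 <= b n) -> b n @[n --> \oo] --> 0 ->
  (N n)%:R * b n @[n --> \oo] --> l ->
  (1 - b n) ^+ N n @[n --> \oo] --> expR (- l).
Proof.
move=> b0 bcvg Nb.
apply: (@squeeze_cvgr _ _ _ _ (fun n => expR (- ((N n)%:R * b n * (1 + b n))))
  (fun n => expR (- ((N n)%:R * b n)))).
- near=> n; have bn0 : 0 <= b n by near: n.
  have b1 : b n <= 1 / 3.
    by near: n; move/cvgr_le : bcvg; apply; lra.
  apply/andP; split; last first.
    by apply: expn_onem_le; apply/andP; split=> //; lra.
  rewrite -mulrA -mulrN expRM_natl; apply: lerXn2r.
  + by rewrite nnegrE expR_ge0.
  + by rewrite nnegrE; lra.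
  + have -> : b n * (1 + b n) = b n + b n ^+ 2 by ring.
    exact: expRN_le_onem.
- apply: (continuous_cvg _ (@continuous_expR R _)); apply: cvgN.
  rewrite -[X in _ --> X]mulr1; apply: cvgM => //.
  rewrite -[X in _ --> X]addr0; apply: cvgD => //; exact: cvg_cst.
- by apply: (continuous_cvg _ (@continuous_expR R _)); apply: cvgN.
Unshelve. all: by end_near. Qed.

End Limits.

(** * The limit for a constant sequence *)

Section ConstantShift.
Variables (R : realType) (c : R).
Let L (n : nat) : R := ln n%:R.
Let w (n : nat) : R := ln (L n).
Let p (n : nat) : R := edge_prob (fun=> c) n.
Let r (n : nat) : R := p n ^+ 2.
(** For large [n] this is [n * r n], the mean number of common neighbours of two vertices of [X]. *)
Let nu (n : nat) : R := 2 * L n + w n + c.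
Let b (n : nat) : R := pair_prob n (p n).

Let Ly : L n @[n --> \oo] --> +oo. Proof. exact/cvgy_ln/cvgr_idn. Qed.
Let wy : w n @[n --> \oo] --> +oo. Proof. exact: cvgy_ln. Qed.
Let LV0 : (L n)^-1 @[n --> \oo] --> 0. Proof. exact: cvgy_inv. Qed.

Let large n : Prop :=
  [/\ 1000 <= L n, w n ^+ 2 / 2 <= L n, L n ^+ 4 / 24 <= n%:R,
      2 * L n <= nu n <= 3 * L n & 1000 <= w n].

(** Once [w n >= 1000 + |c|], all bounds follow from [exp x >= 1 + x^k / k!], with [k = 2] for
    [L = exp w] and [k = 4] for [n = exp L]. *)
Let large_n : \forall n \near \oo, large n.
Proof.
near=> n.
have w1 : 1000 + `|c| <= w n by near: n; move/cvgryPge : wy; exact.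
have w1000 : 1000 <= w n by have := normr_ge0 c; lra.
have wc : - w n <= c <= w n by rewrite -ler_norml; lra.
have L0 : 0 < L n by near: n; move/cvgryPgt : Ly; exact.
have Lw : L n = expR (w n) by rewrite lnK// posrE.
have n0 : (0 < n)%N by near: n; exact: nbhs_infty_gt.
have nL : n%:R = expR (L n) by rewrite lnK// posrE ltr0n.
have wL : w n ^+ 2 / 2 <= L n.
  have := @expR_ge1Dxn R (w n) 1; rewrite -Lw => h.
  by have /h : 0 <= w n by [lra]; rewrite !factS fact0 /=; lra.
have L1000 : 1000 <= L n by nra.
split=> //.
- have := @expR_ge1Dxn R (L n) 3; rewrite -nL => h.
  by have /h : 0 <= L n by [lra]; rewrite !factS fact0 /=; lra.
- rewrite /nu; apply/andP; split; first lra.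
  nra.
Unshelve. all: by end_near. Qed.

(** The constant 72 is [3 * 24], from [nu n <= 3 * L n] and [L n ^+ 4 / 24 <= n]. *)
Let edge_prob_const : \forall n \near \oo,
  [/\ 0 <= p n, r n = nu n / n%:R & r n * L n ^+ 3 <= 72].
Proof.
near=> n.
have [L1 _ nL4 /andP[nu2 nu3] _] : large n by near: n.
have n0 : 0 < n%:R :> R.
  by apply: lt_le_trans nL4; rewrite divr_gt0// exprn_gt0//; lra.
have rE : r n = nu n / n%:R.
  rewrite /r /p /edge_prob sqr_sqrtr// divr_ge0 ?ltW//.
  by rewrite -/(L n) -/(w n) -/(nu n); lra.
split=> //; first exact: sqrtr_ge0.
rewrite rE mulrAC ler_pdivrMr//.
apply: (@le_trans _ _ (3 * L n * L n ^+ 3)); last by lra.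
by rewrite ler_wpM2r// exprn_ge0//; lra.
Unshelve. all: by end_near. Qed.

Let regular n : Prop :=
  [/\ sparse_range n (p n), r n = nu n / n%:R, r n <= 72 * (L n)^-1,
      nu n * r n <= 216 * (L n)^-1 & nu n * p n <= 1].

Let regular_n : \forall n \near \oo, regular n.
Proof.
near=> n.
have [L1 _ nL4 /andP[nu2 nu3] _] : large n by near: n.
have [p0 rE rL] : [/\ 0 <= p n, r n = nu n / n%:R & r n * L n ^+ 3 <= 72].
  by near: n; exact: edge_prob_const.
have L0 : 0 < L n by lra.
have n100 : (100 <= n)%N.
  rewrite -(ler_nat R); apply: le_trans nL4.
  have : 1000 * 1000 <= L n ^+ 2 by rewrite expr2; apply: ler_pM; lra.
  have -> : L n ^+ 4 = L n ^+ 2 * L n ^+ 2 by ring.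
  nra.
have n0 : 0 < n%:R :> R by rewrite ltr0n (leq_trans _ n100).
have nr : n%:R * r n = nu n by rewrite rE mulrC divfK// gt_eqF.
have r0 : 0 < r n by rewrite rE divr_gt0//; lra.
have LL : 1000 * 1000 <= L n ^+ 2 by rewrite expr2; apply: ler_pM; lra.
have rL2 : r n * L n ^+ 2 <= 72 * (L n)^-1.
  by rewrite ler_pdivlMr// -mulrA -exprSr.
have LV : 0 < (L n)^-1 by rewrite invr_gt0.
have LV1 : (L n)^-1 <= 1 / 1000.
  by rewrite -[leLHS]mul1r ler_pdivrMr//; lra.
have rsmall : r n * (1000 * 1000) <= r n * L n ^+ 2 by rewrite ler_wpM2l// ltW.
have rLs : r n * L n * 1000 <= r n * L n ^+ 2.
  by rewrite expr2 mulrA ler_wpM2l// mulr_ge0// ltW.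
have pp : 0 < p n.
  rewrite lt_neqAle p0 andbT eq_sym.
  by apply: contraTneq r0 => h; rewrite /r h expr0n /= ltxx.
(* Squaring removes the root: [(nu n * p n)^2 <= 9 (L n)^2 r n <= 648 / L n], and [L n >= 1000]. *)
have nup : nu n * p n <= 1.
  suff : (nu n * p n) ^+ 2 <= 1 ^+ 2.
    by rewrite ler_pXn2r// nnegrE ?mulr_ge0//; lra.
  rewrite expr1n exprMn -/(r n).
  apply: (@le_trans _ _ ((3 * L n) ^+ 2 * r n)).
    apply: ler_wpM2r; first exact: ltW.
    by rewrite ler_pXn2r// nnegrE; lra.
  by rewrite exprMn; lra.
split=> //.
- split=> //; rewrite -/(L n).
  + rewrite pp /=.
    suff : p n ^+ 2 <= (1 / 1800) ^+ 2 by rewrite ler_pXn2r// nnegrE; lra.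
    by rewrite -/(r n); lra.
  + lra.
  + by rewrite -/(r n) nr.
- by lra.
- have : nu n * r n <= 3 * L n * r n by rewrite ler_wpM2r// ltW.
  lra.
Unshelve. all: by end_near. Qed.

Let r_cvg0 : r n @[n --> \oo] --> 0.
Proof.
apply: (@squeeze_cvgr _ _ _ _ (fun=> 0) (fun n => 72 * (L n)^-1)).
- near=> n; apply/andP; split; first exact: sqr_ge0.
  by have [] : regular n by near: n.
- exact: cvg_cst.
- by rewrite -[X in _ --> X](mulr0 72); apply: cvgMl_tmp.
Unshelve. all: by end_near. Qed.

Let nur_cvg0 : nu n * r n @[n --> \oo] --> 0.
Proof.
apply: (@squeeze_cvgr _ _ _ _ (fun=> 0) (fun n => 216 * (L n)^-1)).
- near=> n; apply/andP; split.
    apply: mulr_ge0; last exact: sqr_ge0.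
    have [L1 _ _ /andP[nu2 _] _] : large n by near: n.
    lra.
  by have [] : regular n by near: n.
- exact: cvg_cst.
- by rewrite -[X in _ --> X](mulr0 216); apply: cvgMl_tmp.
Unshelve. all: by end_near. Qed.

Let wL_cvg0 : w n / L n @[n --> \oo] --> 0.
Proof.
apply: (@squeeze_cvgr _ _ _ _ (fun=> 0) (fun n => 2 * (w n)^-1)).
- near=> n.
  have [L1 wL _ _ w1] : large n by near: n.
  rewrite divr_ge0 /=; [|lra|lra].
  rewrite ler_pdivrMr; last lra.
  rewrite mulrAC ler_pdivlMr; last lra.
  by move: wL; rewrite expr2; lra.
- exact: cvg_cst.
- by rewrite -[X in _ --> X](mulr0 2); apply: cvgMl_tmp; exact: cvgy_inv.
Unshelve. all: by end_near. Qed.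

Let nV0 : (n%:R : R)^-1 @[n --> \oo] --> 0.
Proof. exact/cvgy_inv/cvgr_idn. Qed.

(* [base n] is ['C(n, 2) * (1 + (n - 1) * r n) * expR (- nu n)]. *)
Let base n : R := expR (- c) * (1 - n%:R^-1) *
  (1 + (w n / L n + (c + 1 - r n) * (L n)^-1) / 2).

Let base_cvg : base n @[n --> \oo] --> expR (- c).
Proof.
rewrite -[X in _ --> X]mulr1; apply: cvgM.
  rewrite -[X in _ --> X]mulr1; apply: cvgM; first exact: cvg_cst.
  by rewrite -[X in _ --> X]subr0; apply: cvgB => //; exact: cvg_cst.
rewrite -[X in _ --> X]addr0; apply: cvgD; first exact: cvg_cst.
rewrite -(mul0r 2^-1); apply: cvgMr_tmp.
rewrite -[X in _ --> X]addr0; apply: cvgD => //.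
rewrite -(mulr0 (c + 1 - 0)); apply: cvgM => //.
apply: cvgB => //; exact: cvg_cst.
Qed.

Let natr_bin2 n : (0 < n)%N -> 'C(n, 2)%:R = n%:R * (n%:R - 1) / 2 :> R.
Proof.
case: n => // n _; rewrite bin2 /=.
have : ((n.+1 * n)./2.*2 = n.+1 * n)%N.
  by rewrite -[RHS]odd_double_half oddM /= andNb.
move=> /(congr1 (fun k => k%:R : R)).
rewrite -muln2 !natrM => h.
have -> : n.+1%:R - 1 = n%:R :> R by rewrite -natr1; ring.
by rewrite -h; field.
Qed.

(** As [expR (nu n) = n^2 * L n * e^c], this isolates [base n], whose limit is elementary, from a
    factor that tends to 1. *)
Let NbE : \forall n \near \oo,
  'C(n, 2)%:R * b n = base n * (expR (nu n) * (1 - r n) ^+ n.-1) /\ 0 <= base n.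
Proof.
near=> n.
have [L1 _ nL4 /andP[nu2 nu3] _] : large n by near: n.
have [[n100 /andP[p0 p1] _ _] rE _ _ _] : regular n by near: n.
have n0 : (0 < n)%N by apply: leq_trans n100.
have nr0 : 0 < n%:R :> R by rewrite ltr0n.
have nr1 : 1 <= n%:R :> R by rewrite (ler_nat _ 1).
have nP : n.-1%:R = n%:R - 1 :> R by rewrite -subn1 natrB.
have nuE : expR (nu n) = n%:R ^+ 2 * L n * expR c.
  rewrite /nu !expRD expRM_natl /w lnK ?posrE; last lra.
  by rewrite -natr_expR_ln.
have cE : expR (- c) * expR c = 1 by rewrite -expRD addNr expR0.
have baseE : base n * expR (nu n) =
    n%:R * (n%:R - 1) / 2 * (1 + (n%:R - 1) * r n).
  transitivity (expR (- c) * expR c * (n%:R * (n%:R - 1) / 2) *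
      (2 * L n + w n + c + 1 - r n)).
    rewrite nuE /base; field; apply/andP; split; apply: lt0r_neq0 => //; lra.
  rewrite cE mul1r; congr (_ * _); rewrite -/(nu n).
  have -> : (n%:R - 1) * r n = nu n - r n.
    by rewrite mulrBl mul1r {1}rE mulrC divfK// gt_eqF.
  by rewrite /nu; ring.
split.
  rewrite mulrA baseE natr_bin2// /b /pair_prob -/(r n) nP; ring.
rewrite -(pmulr_lge0 _ (expR_gt0 (nu n))) baseE.
rewrite mulr_ge0 ?divr_ge0 ?mulr_ge0 ?subr_ge0//.
by rewrite addr_ge0// mulr_ge0 ?sqr_ge0// subr_ge0.
Unshelve. all: by end_near. Qed.

(** Bounding [1 - r] by exponentials on both sides leaves the exponents [r - nu r + r^2] and [r],
    both tending to 0 thanks to [nur_cvg0]. *)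
Let Nb_cvg : 'C(n, 2)%:R * b n @[n --> \oo] --> expR (- c).
Proof.
apply: (@squeeze_cvgr _ _ _ _
  (fun n => base n * expR (r n - nu n * r n + r n ^+ 2))
  (fun n => base n * expR (r n))).
- near=> n.
  have [-> base0] : 'C(n, 2)%:R * b n =
    base n * (expR (nu n) * (1 - r n) ^+ n.-1) /\ 0 <= base n by near: n.
  have [[n100 /andP[p0 p1] _ _] rE _ _ _] : regular n by near: n.
  have n0 : (0 < n)%N by apply: leq_trans n100.
  have nP : n.-1%:R = n%:R - 1 :> R by rewrite -subn1 natrB.
  have r0 : 0 <= r n by exact: sqr_ge0.
  have nr : n%:R * r n = nu n by rewrite rE mulrC divfK// gt_eqF// ltr0n.
  have r1 : r n <= 1 / 3.
    apply: (@le_trans _ _ (1 / 1800 * p n)); last lra.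
    by rewrite /r expr2 ler_wpM2r// ltW.
  apply/andP; split; apply: ler_wpM2l => //.
    have -> : r n - nu n * r n + r n ^+ 2 =
        nu n + n.-1%:R * - (r n + r n ^+ 2) by rewrite nP -nr; ring.
    rewrite expRD ler_wpM2l ?expR_ge0// expRM_natl lerXn2r ?nnegrE ?expR_ge0//.
      lra.
    exact: expRN_le_onem.
  have {2}-> : r n = nu n + - (n.-1%:R * r n) by rewrite nP -nr; ring.
  rewrite expRD ler_wpM2l ?expR_ge0//.
  apply: expn_onem_le; apply/andP; split=> //; lra.
- rewrite -[X in _ --> X]mulr1; apply: cvgM => //.
  rewrite -expR0; apply: (continuous_cvg _ (@continuous_expR R _)).
  rewrite -[X in _ --> X](addr0 0); apply: cvgD.
    by rewrite -[X in _ --> X](subr0 0); apply: cvgB.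
  by rewrite -[X in _ --> X](mulr0 0); apply: cvgM.
- rewrite -[X in _ --> X]mulr1; apply: cvgM => //.
  rewrite -expR0; exact: (continuous_cvg _ (@continuous_expR R _)).
Unshelve. all: by end_near. Qed.

Let b_ge0 : \forall n \near \oo, 0 <= b n.
Proof.
near=> n.
have [[n100 /andP[p0 p1] _ _] _ _ _ _] : regular n by near: n.
have r1 : r n <= 1.
  apply: (@le_trans _ _ (1 * p n)); last lra.
  by rewrite /r expr2; apply: ler_wpM2r; lra.
rewrite /b /pair_prob mulr_ge0 ?exprn_ge0 ?subr_ge0//.
by rewrite addr_ge0// mulr_ge0// sqr_ge0.
Unshelve. all: by end_near. Qed.

(** Both quantities are expressed through the convergent ['C(n, 2)%:R * b n], with an explicit
    factor of order [1 / n]. *)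
Let b_bounds : \forall n \near \oo,
  b n <= 'C(n, 2)%:R * b n * (4 * n%:R^-1) /\
  n%:R ^+ 3 * b n ^+ 2 <= ('C(n, 2)%:R * b n) ^+ 2 * (16 * n%:R^-1).
Proof.
near=> n.
have bn0 : 0 <= b n by near: n.
have n100 : (100 <= n)%N by near: n; exact: nbhs_infty_ge.
rewrite natr_bin2 ?(leq_trans _ n100)//.
have : 100 <= n%:R :> R by rewrite (ler_nat _ 100).
move: bn0; set N : R := n%:R; set B := b n => B0 N1.
have N0 : N != 0 by apply: lt0r_neq0; lra.
split.
  have -> : N * (N - 1) / 2 * B * (4 * N^-1) = B * (2 * (N - 1)) by field.
  by rewrite ler_peMr//; lra.
have -> : (N * (N - 1) / 2 * B) ^+ 2 * (16 * N^-1) =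
   (N * B ^+ 2) * (2 * (N - 1)) ^+ 2 by field.
have -> : N ^+ 3 * B ^+ 2 = (N * B ^+ 2) * N ^+ 2 by ring.
apply: ler_wpM2l; first by rewrite mulr_ge0 ?sqr_ge0//; lra.
by rewrite ler_pXn2r// ?nnegrE; lra.
Unshelve. all: by end_near. Qed.

Let b_cvg0 : b n @[n --> \oo] --> 0.
Proof.
apply: (@squeeze_cvgr _ _ _ _ (fun=> 0)
  (fun n => 'C(n, 2)%:R * b n * (4 * n%:R^-1))).
- near=> n; apply/andP; split; first by near: n.
  by have [] : b n <= 'C(n, 2)%:R * b n * (4 * n%:R^-1) /\
    n%:R ^+ 3 * b n ^+ 2 <= ('C(n, 2)%:R * b n) ^+ 2 * (16 * n%:R^-1) by near: n.
- exact: cvg_cst.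
- rewrite -[X in _ --> X](mulr0 (expR (- c))); apply: cvgM => //.
  by rewrite -[X in _ --> X](mulr0 4); apply: cvgMl_tmp.
Unshelve. all: by end_near. Qed.

(** The terms account for two meeting pairs both bad, for the products of their probabilities, and
    for sets of size at least 3. *)
Let error n : R := 128 * (L n)^-1 +
  ('C(n, 2)%:R * b n) ^+ 2 * (16 * n%:R^-1) + 4 * (L n)^-1.

Let error_cvg0 : error n @[n --> \oo] --> 0.
Proof.
rewrite -[X in _ --> X]addr0; apply: cvgD; last first.
  by rewrite -[X in _ --> X](mulr0 4); apply: cvgMl_tmp.
rewrite -[X in _ --> X]addr0; apply: cvgD.
  by rewrite -[X in _ --> X](mulr0 128); apply: cvgMl_tmp.
rewrite -[X in _ --> X](mulr0 (expR (- c) * expR (- c))); apply: cvgM.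
  exact: cvgM.
by rewrite -[X in _ --> X](mulr0 16); apply: cvgMl_tmp.
Qed.

Let expRN_le_inv (y : R) : -1 < y -> expR (- y) <= (1 + y)^-1.
Proof.
move=> y1; rewrite expRN lef_pV2 ?posrE ?expR_gt0//; last lra.
exact: expR_ge1Dx.
Qed.

(** The exponent is at most [3 L - 7/4 nu + nu p <= 1 - L / 2], and [exp (1 - L / 2) <= 2 / L]. The
    Chernoff weight [1/8] makes [7/4 * 2] exceed 3. *)
Let two_pairs_le : \forall n \near \oo,
  n%:R ^+ 3 * two_pairs_bound n (p n) <= 128 * (L n)^-1.
Proof.
near=> n.
have [[n100 /andP[p0 p1] L1 npL] rE _ _ nup] : regular n by near: n.
have L10 : 1000 <= L n by near: n; move/cvgryPge : Ly; exact.
have n0 : (0 < n)%N by apply: leq_trans n100.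
have nr : n%:R * r n = nu n by rewrite rE mulrC divfK// gt_eqF// ltr0n.
have nur : 2 * L n <= nu n by rewrite -nr.
pose x := 7 / 4 * r n - p n * r n.
have h1 : (1 - 7 / 4 * p n ^+ 2 + 49 / 64 * p n ^+ 3) ^+ n <= expR (n%:R * - x).
  rewrite expRM_natl; apply: lerXn2r; rewrite ?nnegrE ?expR_ge0//.
    have -> : 1 - 7 / 4 * p n ^+ 2 + 49 / 64 * p n ^+ 3 =
      (1 - p n) + p n * (1 - 7 / 8 * p n) ^+ 2 by field.
    apply: addr_ge0; first lra.
    by rewrite mulr_ge0 ?sqr_ge0// ltW.
  apply: le_trans (onem_le_expRN _); rewrite /x /r.
  have : 0 <= p n ^+ 3 by rewrite exprn_ge0// ltW.
  have -> : p n * p n ^+ 2 = p n ^+ 3 by ring.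
  lra.
rewrite /two_pairs_bound mulrCA.
have -> : 128 * (L n)^-1 = 64 * (L n / 2)^-1 by field; apply: lt0r_neq0; lra.
rewrite ler_wpM2l//.
apply: (@le_trans _ _ (expR (3 * L n) * expR (n%:R * - x))).
  rewrite ler_pM ?exprn_ge0//; last by rewrite expRM_natl -natr_expR_ln.
  have -> : 1 - 7 / 4 * p n ^+ 2 + 49 / 64 * p n ^+ 3 =
    (1 - p n) + p n * (1 - 7 / 8 * p n) ^+ 2 by field.
  apply: addr_ge0; first lra.
  by rewrite mulr_ge0 ?sqr_ge0// ltW.
rewrite -expRD.
have -> : (L n / 2)^-1 = (1 + (L n / 2 - 1))^-1 by congr (_^-1); ring.
apply: le_trans (expRN_le_inv _); last lra.
have -> : n%:R * - x = - (7 / 4 * nu n - nu n * p n) by rewrite /x -nr; ring.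
by rewrite ler_expR; lra.
Unshelve. all: by end_near. Qed.

Lemma double_Hall_const_cvg :
  Gnnp_Pr (edge_prob (fun=> c) n) (@double_Hall 'I_n 'I_n) @[n --> \oo] -->
  expR (- expR (- c)).
Proof.
apply: (@cvg_sub0 _ _ _ _ _ _ (fun n => (1 - b n) ^+ 'C(n, 2))); last first.
  exact: cvg_onem_expn.
apply/norm_cvg0P.
apply: (@squeeze_cvgr _ _ _ _ (fun=> 0) error) => //; last exact: cvg_cst.
near=> n; rewrite normr_ge0 /=.
have sr : sparse_range n (p n).
  by have [] : regular n by near: n.
have [n100 /andP[p0 p1]] := sr; rewrite -/(L n) => L1 _.
have n2 : (2 <= n)%N by apply: leq_trans n100.
have p01 : 0 <= p n <= 1 by apply/andP; split; lra.
apply: le_trans (double_Hall_approx n2 p01) _.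
rewrite /error mulrDr; apply: lerD.
  apply: lerD; first by near: n.
  by have [] : b n <= 'C(n, 2)%:R * b n * (4 * n%:R^-1) /\
    n%:R ^+ 3 * b n ^+ 2 <= ('C(n, 2)%:R * b n) ^+ 2 * (16 * n%:R^-1) by near: n.
apply: le_trans (sum_large_set_bound sr) _.
have -> : 4 * (L n)^-1 = 2 * (L n / 2)^-1 by field; apply: lt0r_neq0; lra.
rewrite ler_wpM2l//.
apply: le_trans (expRN_le_inv _) _; first by rewrite -/(L n); lra.
by rewrite -/(L n) lef_pV2 ?posrE; lra.
Unshelve. all: by end_near. Qed.

Lemma edge_prob_const_range :
  \forall n \near \oo, 0 <= edge_prob (fun=> c) n <= 1.
Proof.
near=> n.
have [[_ /andP[p0 p1] _ _] _ _ _ _] : regular n by near: n.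
rewrite -/(p n); apply/andP; split; lra.
Unshelve. all: by end_near. Qed.

End ConstantShift.

(** * Sandwiching between constant sequences *)

Section Sandwich.
Variable R : realType.
Implicit Types (c : nat -> R) (a e : R).

Lemma edge_prob_le c c' n : c n <= c' n -> edge_prob c n <= edge_prob c' n.
Proof.
move=> cc'; apply: ler_wsqrtr; apply: ler_wpM2r; first by rewrite invr_ge0.
by rewrite lerD2l.
Qed.

Let Pr c n := Gnnp_Pr (edge_prob c n) (@double_Hall 'I_n 'I_n).

Lemma Pr_double_Hall_le c a e :
    (\forall n \near \oo, edge_prob_valid c n) ->
    (\forall n \near \oo, c n <= a) -> expR (- expR (- a)) < e ->
  \forall n \near \oo, Pr c n <= e.
Proof.
move=> hp ca ae; near=> n.
have [_ /andP[p0 p1]] : edge_prob_valid c n by near: n.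
have /andP[q0 q1] : 0 <= edge_prob (fun=> a) n <= 1.
  by near: n; exact: edge_prob_const_range.
apply: (@le_trans _ _ (Pr (fun=> a) n)).
  apply: Gnnp_double_Hall_mono => //; apply: edge_prob_le; by near: n.
by near: n; move/cvgr_le : (@double_Hall_const_cvg R a); exact.
Unshelve. all: by end_near. Qed.

Lemma Pr_double_Hall_ge c a e :
    (\forall n \near \oo, edge_prob_valid c n) ->
    (\forall n \near \oo, a <= c n) -> e < expR (- expR (- a)) ->
  \forall n \near \oo, e <= Pr c n.
Proof.
move=> hp ca ae; near=> n.
have [_ /andP[p0 p1]] : edge_prob_valid c n by near: n.
have /andP[q0 q1] : 0 <= edge_prob (fun=> a) n <= 1.
  by near: n; exact: edge_prob_const_range.
apply: (@le_trans _ _ (Pr (fun=> a) n)).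
  by near: n; move/cvgr_ge : (@double_Hall_const_cvg R a); exact.
apply: Gnnp_double_Hall_mono => //; apply: edge_prob_le; by near: n.
Unshelve. all: by end_near. Qed.

Lemma Pr_double_Hall_01 c : (\forall n \near \oo, edge_prob_valid c n) ->
  \forall n \near \oo, 0 <= Pr c n <= 1.
Proof.
move=> hp; near=> n.
have [_ p01] : edge_prob_valid c n by near: n.
rewrite /Pr Gnnp_PrE; apply/andP; split.
  by apply: sumr_ge0 => G _; rewrite mulr_ge0 ?bern_ge0.
apply: le_trans (_ : Ebern _ (fun=> 1) <= 1); last by rewrite Ebern1.
by apply: Ebern_le => // G; case: (double_Hall G).
Unshelve. all: by end_near. Qed.

End Sandwich.

Theorem theorem1p12 (R : realType) (c : nat -> R)
    (hp : \forall n \near \oo, edge_prob_valid c n) :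
  let Pr_dH := fun n : nat =>
    @Gnnp_Pr R n (edge_prob c n) (@double_Hall 'I_n 'I_n) in
  [/\ c n @[n --> \oo] --> -oo -> Pr_dH n @[n --> \oo] --> (0 : R),
      forall c0 : R, c n @[n --> \oo] --> c0 ->
        Pr_dH n @[n --> \oo] --> expR (- expR (- c0))
    & c n @[n --> \oo] --> +oo -> Pr_dH n @[n --> \oo] --> (1 : R)].
Proof.
move=> Pr_dH; split.
- move=> /cvgrNyPle cNy; apply/cvgrPdist_le => e e0; near=> n.
  have /andP[P0 _] : 0 <= Pr_dH n <= 1 by near: n; exact: Pr_double_Hall_01.
  rewrite sub0r normrN ger0_norm//; near: n.
  (* With [a = ln e], [exp (- a) >= 1 - a > - a], so the limit for [a] is below [exp a = e]. *)
  apply: (@Pr_double_Hall_le _ _ (ln e)) => //.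
  rewrite -[ltRHS]lnK ?posrE// ltr_expR.
  have := expR_ge1Dx (- ln e); lra.
- move=> c0 cc0; apply/cvgrPdist_le => e e0.
  pose f (x : R) : R := expR (- expR (- x)).
  have fc : f x @[x --> c0] --> f c0.
    apply: (continuous_cvg _ (@continuous_expR R _)); apply: cvgN.
    by apply: (continuous_cvg _ (@continuous_expR R _)); apply: cvgN.
  have : \forall x \near c0, `|f c0 - f x| < e.
    by move/cvgrPdist_lt : fc; exact.
  move=> /nbhs_ballP[d /= d0 fd].
  have h a : `|c0 - a| < d -> f c0 - e < f a < f c0 + e.
    by move=> /fd /=; rewrite ltr_distlC => /andP[? ?]; apply/andP; split; lra.
  (* The constants [c0 - d / 2] and [c0 + d / 2] eventually enclose [c n], and by continuity their
     limits are within [e] of [f c0]. *)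
  near=> n; rewrite distrC ler_distl; apply/andP; split; near: n.
    apply: (@Pr_double_Hall_ge _ _ (c0 - d / 2)) => //.
      by move/cvgr_ge : cc0; apply; lra.
    have /h /andP[//] : `|c0 - (c0 - d / 2)| < d.
    by rewrite opprB addrCA subrr addr0 ger0_norm; lra.
  apply: (@Pr_double_Hall_le _ _ (c0 + d / 2)) => //.
    by move/cvgr_le : cc0; apply; lra.
  have /h /andP[//] : `|c0 - (c0 + d / 2)| < d.
  by rewrite opprD addrA subrr add0r normrN ger0_norm; lra.
- move=> /cvgryPge cy; apply/cvgrPdist_le => e e0; near=> n.
  have /andP[_ P1] : 0 <= Pr_dH n <= 1 by near: n; exact: Pr_double_Hall_01.
  rewrite ger0_norm ?subr_ge0// lerBlDr addrC -lerBlDr; near: n.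
  (* With [a = 1 - ln e], the limit is at least [1 - exp (- a) = 1 - exp (ln e - 1) > 1 - e]. *)
  apply: (@Pr_double_Hall_ge _ _ (1 - ln e)) => //.
  apply: lt_le_trans (expR_ge1Dx _).
  rewrite ltrD2l ltrN2 -[ltRHS]lnK ?posrE// ltr_expR; lra.
Unshelve. all: by end_near. Qed.
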